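(* Let $G=(V,E)$ be a finite simple graph with $c=c(G)$ connected components and a fixed orientation $\vec E$ of its edges. Let $H$ be a real symmetric matrix strictly supported on $G$, let $\lambda$ be an eigenvalue of $H$ with upper label $k^\uparrow$, and let $\psi\in\ker(H-\lambda)$ be a real eigenvector of $H$ with no zero entries. Define edge weights $r=\{r_e\}_{e\in\vec E}$ by $$r_e = -(\psi_u H_{u,v}\psi_v)^{-1}\qquad\text{for each } e=(u,v)\in\vec E,$$ and let $\mathcal X_r$ be the corresponding weighted cycle intersection form. Then the multiplicity of the eigenvalue $\lambda$ is $$\dim\ker(H-\lambda) = c + n_0(\mathcal X_r),$$ and the nodal count of $\psi$ is $$\varphi(\psi,H) = k^\uparrow - c + n_-(\mathcal X_r).$$
   Context: Let $G=(V,E)$ be a simple graph with finite vertex set $V$; $u\sim v$ means $\{u,v\}\in E$. An orientation $\vec E$ contains, for each edge $\{u,v\}\in E$, exactly one of the ordered pairs $(u,v)$, $(v,u)$. The space of $1$-chains is $C_1(G,\mathbb R)=\{\sum_{e\in\vec E}y_e e : y_e\in\mathbb R\}\simeq\mathbb R^{\vec E}$. The cycle space $Z=H_1(G,\mathbb R)\subset C_1(G,\mathbb R)$ is the set of $1$-chains $y$ such that for every $u\in V$, $\sum_{v:(v,u)\in\vec E}y_{(v,u)}=\sum_{w:(u,w)\in\vec E}y_{(u,w)}$. For a vector $r=\{r_e\}_{e\in\vec E}$ of real edge weights let $\mathcal R(y,y')=\sum_{e\in\vec E}r_e y_e y'_e$ on $C_1(G,\mathbb R)$. The weighted cycle intersection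 form $\mathcal X_r$ is the restriction of the symmetric bilinear form $\mathcal R$ to $Z$. For a symmetric bilinear form $\mathcal B$ on a finite-dimensional real vector space $W$, $n_0(\mathcal B)=\dim\{w\in W:\mathcal B(w,w')=0\ \forall w'\in W\}$ is its nullity, and $n_-(\mathcal B)$, its Morse index, is the maximal dimension of a subspace on which $\mathcal B$ is negative definite. A real symmetric matrix $H$ with rows and columns indexed by $V$ is strictly supported on $G$ if for any two distinct vertices $u\ne v$: $H_{u,v}\neq0$ if and only if $u\sim v$ (diagonal entries are arbitrary). Its eigenvalues are ordered $\lambda_1(H)\le\lambda_2(H)\le\dots\le\lambda_n(H)$, $n=|V|$. The upper label of an eigenvalue $\lambda$ is $k^\uparrow=\max\{k:\lambda_k(H)=\lambda\}$. The nodal count of a real vector $\psi$ with no zero entries is $$\varphi(\psi,H)=\#\{(u,v)\in\vec E:\psi_uH_{u,v}\psi_v>0\}.$$ *)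

(* Defs.v *)
From HB Require Import structures.
From mathcomp Require Import all_boot all_order all_algebra.
From mathcomp Require Import boolp polyrcf complex spectral.

Set Implicit Arguments.
Unset Strict Implicit.
Unset Printing Implicit Defensive.
Import Order.TTheory GRing.Theory Num.Theory.
Local Open Scope ring_scope.

(* A graph on the finite type V is given by its adjacency relation e, assumed
   symmetric and irreflexive; an oriented edge (u, v) points from u to v. *)
Definition orientation (V : finType) (e : rel V) (D : {set V * V}) : Prop :=
  (forall u v, (u, v) \in D -> e u v) /\
  (forall u v, e u v -> ((u, v) \in D) (+) ((v, u) \in D)).

Definition arc (V : finType) (D : {set V * V}) : finType :=
  {a : V * V | a \in D}.

Section Arcs.
Variables (V : finType) (D : {set V * V}).
Definition src (a : arc D) : V := (val a).1.
Definition tgt (a : arc D) : V := (val a).2.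
End Arcs.

Notation chain R D := {ffun arc D -> R^o}.

Section Cycles.
Variables (R : rcfType) (V : finType) (D : {set V * V}).

Definition inflow (y : chain R D) (u : V) : R := \sum_(a | tgt a == u) y a.
Definition outflow (y : chain R D) (u : V) : R := \sum_(a | src a == u) y a.

Definition boundary (y : chain R D) : {ffun V -> R^o} :=
  [ffun u => inflow y u - outflow y u].

Lemma boundary_is_linear : linear boundary.
Proof.
move=> c y z; apply/ffunP => u; rewrite !ffunE /inflow /outflow.
rewrite scalerBr addrACA -opprD !scaler_sumr -!big_split /=.
by congr (_ - _); apply: eq_bigr => a _; rewrite !ffunE.
Qed.
HB.instance Definition _ := GRing.isLinear.Build R _ _ _ boundary
  boundary_is_linear.

Definition cycle_space : {vspace chain R D} := lker (linfun boundary).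

Lemma cycle_spaceP (y : chain R D) :
  reflect (forall u, inflow y u = outflow y u) (y \in cycle_space).
Proof.
rewrite memv_ker lfunE /=; apply: (iffP eqP) => [/ffunP y0 u | y0].
  by move/eqP: (y0 u); rewrite !ffunE subr_eq0 => /eqP.
by apply/ffunP => u; rewrite !ffunE y0 subrr.
Qed.

Definition edge_form (r : arc D -> R) (y y' : chain R D) : R :=
  \sum_a r a * y a * y' a.

Definition cycle_form (r : arc D -> R) (y y' : subvs_of cycle_space) : R :=
  edge_form r (vsval y) (vsval y').

Section Forms.
Variable r : arc D -> R.

Lemma edge_form_linearl y' : scalar (edge_form r ^~ y').
Proof.
move=> c y z; rewrite /edge_form mulr_sumr -big_split /=.
by apply: eq_bigr => a _; rewrite !ffunE mulrDr mulrDl /= mulrCA -!mulrA.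
Qed.

Lemma edge_formC y y' : edge_form r y y' = edge_form r y' y.
Proof. by apply: eq_bigr => a _; rewrite mulrAC. Qed.

Lemma edge_form_linearr y : scalar (edge_form r y).
Proof.
by move=> c y' z; rewrite ![edge_form r y _]edge_formC edge_form_linearl.
Qed.

HB.instance Definition _ := bilinear_isBilinear.Build R _ _ R _ _
  (edge_form r) (conj edge_form_linearl edge_form_linearr).
HB.instance Definition _ := @isHermitianSesquilinear.Build R _ false idfun
  (edge_form r) (fun y y' => etrans (edge_formC y y') (esym (mul1r _))).

Lemma cycle_form_linearl y' : scalar (cycle_form r ^~ y').
Proof. by move=> c y z; rewrite /cycle_form linearP edge_form_linearl. Qed.

Lemma cycle_form_linearr y : scalar (cycle_form r y).
Proof. by move=> c y' z; rewrite /cycle_form linearP edge_form_linearr. Qed.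

HB.instance Definition _ := bilinear_isBilinear.Build R _ _ R _ _
  (cycle_form r) (conj cycle_form_linearl cycle_form_linearr).
HB.instance Definition _ := @isHermitianSesquilinear.Build R _ false idfun
  (cycle_form r)
  (fun y y' => etrans (edge_formC (vsval y) (vsval y')) (esym (mul1r _))).

End Forms.
End Cycles.

Section FormIndices.
Variables (R : rcfType) (W : vectType R) (B : {symmetric W}).

Definition nullity : nat := \dim (orthov B fullv).

Definition negative_definite_on (U : {vspace W}) : Prop :=
  forall w, w \in U -> w != 0 -> B w w < 0.

Definition morse_index : nat :=
  \max_(d < (\dim {:W}).+1 |
        `[< exists2 U, negative_definite_on U & \dim U = d >]) d.

End FormIndices.

Section Matrices.
Variables (R : rcfType) (V : finType).

(* 'M_#|V| and 'rV_#|V| are indexed by V through enum_rank. Eigenvectors are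
   row vectors, as in eigenspace; H is symmetric in all uses, so this makes no
   difference. *)
Definition entry (H : 'M[R]_#|V|) (u v : V) : R :=
  H (enum_rank u) (enum_rank v).
Definition coor (psi : 'rV[R]_#|V|) (u : V) : R := psi 0 (enum_rank u).

Definition strictly_supported (e : rel V) (H : 'M[R]_#|V|) : Prop :=
  forall u v, u != v -> (entry H u v != 0) = e u v.

Definition nodal_count (D : {set V * V}) (psi : 'rV[R]_#|V|)
    (H : 'M[R]_#|V|) : nat :=
  #|[set a in D | 0 < coor psi a.1 * entry H a.1 a.2 * coor psi a.2]|.

Definition nodal_weight (D : {set V * V}) (psi : 'rV[R]_#|V|)
    (H : 'M[R]_#|V|) (a : arc D) : R :=
  - (coor psi (src a) * entry H (src a) (tgt a) * coor psi (tgt a))^-1.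

End Matrices.

(* The eigenvalues in R of H in nondecreasing order, each repeated according
   to its multiplicity as a root of the characteristic polynomial; rootsR is
   strictly increasing. *)
Definition eigenvalues (R : rcfType) (n : nat) (H : 'M[R]_n) : seq R :=
  flatten [seq nseq (mup x (char_poly H)) x | x <- rootsR (char_poly H)].

Lemma char_poly_split (R : rcfType) n (H : 'M[R]_n) : H^T = H ->
  exists s : seq R, char_poly H = \prod_(x <- s) ('X - x%:P).
Proof.
move=> Hs; pose C := R[i]; pose f : {rmorphism R -> C} := real_complex R.
pose A := map_mx f H.
have Ah : A \is hermsymmx.
  apply/is_hermitianmxP; rewrite expr0 scale1r; apply/matrixP => i j.
  by rewrite !mxE conj_Creal ?complex_real // -{1}Hs mxE.
have /mxOverP Dr := hermitian_spectral_diag_real Ah.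
have /orthomx_spectralP EA := hermitian_normalmx Ah.
set P := spectralmx A in EA; set D := spectral_diag A in EA Dr.
exists [seq complex.Re (D 0 i) | i <- enum 'I_n].
apply: (map_inj_poly (fmorph_inj f) (rmorph0 f)).
rewrite /= map_char_poly -/A rmorph_prod big_map.
have -> : char_poly A = char_poly (diag_mx D).
  have Pu := spectral_unit A.
  have EAP : P *m A = diag_mx D *m P.
    by rewrite EA mulmxA mulmxA mulmxV // mul1mx.
  have Pp : map_mx polyC P \in unitmx.
    by rewrite unitmxE det_map_mx rmorph_unit.
  rewrite /char_poly; apply: (@mulIr _ (\det (map_mx polyC P))).
    by rewrite -unitmxE.
  rewrite [LHS]mulrC -!det_mulmx; congr (\det _).
  rewrite /char_poly_mx mulmxBr mulmxBl -!map_mxM EAP.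
  by rewrite mul_mx_scalar mul_scalar_mx.
rewrite char_poly_trig ?diag_mx_is_trig // big_enum /=.
apply: eq_bigr => i _; rewrite map_polyXsubC mxE eqxx mulr1n /=.
by rewrite RRe_real.
Qed.

Lemma eigenvalues_sorted (R : rcfType) n (H : 'M[R]_n) :
  sorted <=%R (eigenvalues H).
Proof.
rewrite /eigenvalues; set p := char_poly H.
have: sorted <%R (rootsR p) by rewrite sorted_roots.
elim: (rootsR p) => //= x s IH; rewrite (path_sortedE lt_trans) => /andP[/allP xs ss].
elim: (mup x p) => [|[|m] IHm] /=; first exact: IH.
  rewrite (path_sortedE le_trans) IH // andbT; apply/allP => z /flatten_mapP[y ys].
  by rewrite mem_nseq => /andP[_ /eqP->]; rewrite ltW ?xs.
by rewrite /= lexx.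
Qed.

Lemma char_poly_eigenvalues (R : rcfType) n (H : 'M[R]_n) : H^T = H ->
  char_poly H = \prod_(x <- eigenvalues H) ('X - x%:P).
Proof.
move=> /char_poly_split[s Es]; rewrite {1}Es; apply: perm_big.
apply/allP => x _; rewrite /= -mu_prod_XsubC -Es; apply/eqP.
rewrite /eigenvalues; set p := char_poly H.
have p0 : p != 0 by rewrite monic_neq0 // char_poly_monic.
have ur : uniq (rootsR p) by apply: (sorted_uniq lt_trans ltxx); rewrite sorted_roots.
have mr : (x \in rootsR p) = root p x by rewrite -roots_on_rootsR // in_itv.
rewrite count_flatten -map_comp sumnE big_map.
rewrite (eq_bigr (fun y => (y == x) * mup y p)%N); last first.
  by move=> y _; rewrite /= count_nseq.
case: (boolP (x \in rootsR p)) => [xr | xr].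
  rewrite (bigD1_seq x) //= eqxx mul1n big1 ?addn0 // => y /negPf->.
  by rewrite mul0n.
rewrite mupNroot -?mr // big_seq big1 // => y yr.
by case: eqP yr xr => // -> ->.
Qed.

(* Labels start at 1, so that the entry of index k has label k + 1. *)
Definition upper_label (R : rcfType) (n : nat) (H : 'M[R]_n) (lam : R) : nat :=
  \max_(k < size (eigenvalues H) | (eigenvalues H)`_k == lam) k.+1.

(* Main.v *)
From HB Require Import structures.
Require Import Defs.
From mathcomp Require Import all_boot all_order all_algebra.
From mathcomp Require Import boolp complex spectral ring lra zify.

Set Implicit Arguments.
Unset Strict Implicit.
Unset Printing Implicit Defensive.
Import Order.TTheory GRing.Theory Num.Theory.
Local Open Scope ring_scope.
Local Notation arc := Defs.arc.

(** Multiplying H - lam on both sides by the diagonal matrix of psi turns it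
    into a weighted graph Laplacian: since (H - lam) psi = 0, for phi = x psi
    (entrywise)

      phi (H - lam) phi^T = \sum_(a = (u, v)) (x_v - x_u)^2 / r_a,

    with r the nodal weight. Let d be the coboundary x |-> (x_v - x_u) and give
    the chains the nondegenerate diagonal form W(z) = \sum_a z_a^2 / r_a. Then
    H - lam is the pullback of W along d, while the cycle form X_r is the
    pullback of W along y |-> r y, which maps the cycle space Z onto the
    W-orthogonal complement of the coboundaries im d. So both halves of the
    theorem compare a form on im d with the form on its orthogonal complement.

    Nullity: both restrictions have the radical im d :&: (im d)^W, and
    passing from H - lam to im d loses ker d, of dimension c; this is
    [dim_ker_laplacian], with [dim_ker_nodal_laplacian] translating back to H.

    Index: W is diagonal, so a subspace on which W <= 0 has dimension at most
    the number of arcs with r_a < 0, which is the nodal count nu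
    ([dim_nonpos_chains]). If N is negative definite for H - lam and M is a
    subspace of Z with X_r <= 0 on M, then d N and r M are W-orthogonal and
    independent, so dim N + dim M <= nu ([dim_negative_add]). The spectral
    theorem allows dim N to be the number of eigenvalues below lam, and M can
    be taken of dimension n_- + n_0 for X_r ([semidefinite_subspaces]). The
    same bound for - r gives a lower bound for #|E| - nu. By Euler's relation
    dim Z = #|E| - #|V| + c the two bounds add up to #|E|, so that both are
    equalities:

      nu = #{eigenvalues < lam} + n_- + n_0.

    As k, the number of eigenvalues <= lam, exceeds #{eigenvalues < lam} by
    the multiplicity c + n_0, this is nu = k - c + n_-. *)

(** * Linear maps between finite-dimensional spaces *)

Lemma lfun_of_linear (F : fieldType) (aT rT : vectType F) (f : aT -> rT) :
  linear f -> {g : 'Hom(aT, rT) | g =1 f}.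
Proof.
move=> f_lin; pose fL := GRing.isLinear.Build F _ _ _ f f_lin.
pose h : {linear aT -> rT} := HB.pack f fL.
by exists (linfun h) => x; rewrite lfunE.
Qed.

Lemma dim_ffun (F : fieldType) (I : finType) : \dim {:{ffun I -> F^o}} = #|I|.
Proof. by rewrite dimvf /dim /= muln1. Qed.

Lemma dim_cap_lker_ge (F : fieldType) (aT rT : vectType F) (f : 'Hom(aT, rT))
    (U : {vspace aT}) : (\dim U <= \dim (U :&: lker f) + \dim {:rT})%N.
Proof. by rewrite -[X in (X <= _)%N](limg_ker_dim f U) leq_add2l dimvS ?subvf. Qed.

Lemma dim_le_inj (F : fieldType) (aT rT : vectType F) (f : 'Hom(aT, rT))
    (U : {vspace aT}) :
  {in U, forall x, f x = 0 -> x = 0} -> (\dim U <= \dim {:rT})%N.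
Proof.
move=> inj; rewrite -(@limg_dim_eq _ _ _ f) ?dimvS ?subvf //.
apply/eqP; rewrite -subv0; apply/subvP => x; rewrite memv_cap memv_ker memv0.
by case/andP => xU /eqP /(inj _ xU) ->.
Qed.

(** * Semidefinite subspaces of a symmetric form *)

Section Forms.
Variables (R : rcfType) (W : vectType R) (B : {symmetric W}).

Lemma formC u v : B u v = B v u.
Proof. by rewrite hermC /= expr0 mul1r. Qed.

Lemma form_sqrD (t : R) u v : B (u + t *: v) (u + t *: v) =
  B u u + t *+ 2 * B u v + t ^+ 2 * B v v.
Proof.
rewrite linearDl !linearDr /= !linearZl_LR /= !linearZr_LR /= (formC v u).
ring.
Qed.

(** The orthogonal of U is cut out by the \dim U equations given by a basis. *)
Lemma dim_orthov_ge (U : {vspace W}) :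
  (\dim {:W} <= \dim U + \dim (orthov B U))%N.
Proof.
pose g (w : W) : {ffun 'I_(\dim U) -> R^o} :=
    [ffun i : 'I_(\dim U) => B w (vbasis U)`_i].
have [|G GE] := @lfun_of_linear _ _ _ g.
  by move=> c u v; apply/ffunP => i; rewrite !ffunE linearPl.
have := dim_cap_lker_ge G fullv.
rewrite capfv dim_ffun card_ord addnC => /leq_trans; apply; rewrite leq_add2l.
apply/dimvS/subvP => w; rewrite memv_ker GE => /eqP /ffunP g0.
apply/mem_orthovP => v /coord_vbasis ->; rewrite linear_sumr big1 // => i _.
by have := g0 i; rewrite !ffunE linearZr_LR /= => ->; rewrite mulr0.
Qed.

Lemma morse_index_attained :
  exists2 N : {vspace W}, negative_definite_on B N & \dim N = morse_index B.
Proof.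
rewrite /morse_index; pose A (d : 'I_(\dim {:W}).+1) :=
  `[< exists2 U, negative_definite_on B U & \dim U = d >].
have [d /asboolP Ad] : {d : 'I_(\dim {:W}).+1 | d \in A &
    \max_(d < (\dim {:W}).+1 | A d) d = d :> nat}.
  apply: eq_bigmax_cond; apply/card_gt0P; exists ord0; apply/asboolP.
  by exists 0%VS; [move=> w; rewrite memv0 => /eqP ->; rewrite eqxx
                 | rewrite dimv0].
by move=> ->; case: Ad => U ? ?; exists U.
Qed.

Lemma leq_morse_index (N : {vspace W}) :
  negative_definite_on B N -> (\dim N <= morse_index B)%N.
Proof.
move=> Nneg; have dN : (\dim N < (\dim {:W}).+1)%N by rewrite ltnS dimvS ?subvf.
rewrite -[\dim N]/(nat_of_ord (Ordinal dN)).
by apply: leq_bigmax_cond; apply/asboolP; exists N.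
Qed.

(** Take N negative definite of maximal dimension. Then N plus the radical is
    negative semidefinite, and the orthogonal of N is positive semidefinite, as
    a vector q of negative square orthogonal to N would enlarge N. *)
Lemma semidefinite_subspaces : exists M Q : {vspace W},
  [/\ {in M, forall w, B w w <= 0}, {in Q, forall w, 0 <= B w w},
      \dim M = (morse_index B + nullity B)%N
    & (\dim {:W} <= morse_index B + \dim Q)%N].
Proof.
have [N Nneg dN] := morse_index_attained.
exists (N + orthov B fullv)%VS, (orthov B N); split.
- move=> _ /memv_addP[u uN [k /mem_orthovP kK ->]].
  rewrite -[k]scale1r form_sqrD formC !kK ?memvf // !mulr0 !addr0.
  by have [-> | /(Nneg _ uN) /ltW //] := eqVneq u 0; rewrite linear0l.
- move=> q /mem_orthovP qN; rewrite leNgt; apply/negP => qneg.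
  have q0 : q != 0 by apply: contraTneq qneg => ->; rewrite linear0l ltxx.
  have negNq : negative_definite_on B (N + <[q]>)%VS.
    move=> _ /memv_addP[u uN [_ /vlineP[t ->] ->]] w0.
    rewrite form_sqrD formC qN // mulr0 addr0.
    have [t0 | t0] := eqVneq t 0.
      rewrite t0 expr0n mul0r addr0; apply: Nneg => //.
      by move: w0; rewrite t0 scale0r addr0.
    have : t ^+ 2 * B q q < 0 by rewrite pmulr_rlt0 // exprn_even_gt0.
    have [-> | u0] := eqVneq u 0; first by rewrite linear0l add0r.
    by have := Nneg _ uN u0; lra.
  have := leq_morse_index negNq; rewrite dimv_disjoint_sum ?dim_vline ?q0 ?dN.
    lia.
  apply/eqP; rewrite -subv0; apply/subvP => u; rewrite memv_cap memv0.
  case/andP => uN /vlineP[t uE]; apply: contraTT isT => u0.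
  by have := Nneg _ uN u0; rewrite {1}uE linearZl_LR /= qN // mulr0 ltxx.
- rewrite dimv_disjoint_sum ?dN //; apply/eqP; rewrite -subv0.
  apply/subvP => u; rewrite memv_cap memv0 => /andP[uN /mem_orthovP uK].
  by apply: contraTT isT => /(Nneg _ uN); rewrite uK ?memvf ?ltxx.
- by rewrite -dN dim_orthov_ge.
Qed.

End Forms.

(** * Coboundaries and cycles of a graph *)

Section Graph.
Variables (R : rcfType) (V : finType) (e : rel V) (D : {set V * V}).
Hypotheses (e_sym : symmetric e) (D_orientation : orientation e D).

Definition coboundary (x : {ffun V -> R^o}) : chain R D :=
  [ffun a => x (tgt a) - x (src a)].

Lemma coboundary_is_linear : linear coboundary.
Proof.
move=> c x y; apply/ffunP => a; rewrite !ffunE scalerBr opprD addrACA.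
by rewrite ?scaleNr.
Qed.
HB.instance Definition _ := GRing.isLinear.Build R _ _ _ coboundary
  coboundary_is_linear.

(** Summation by parts: the coboundary is the transpose of the boundary. *)
Lemma coboundary_adjoint (y : chain R D) (x : {ffun V -> R^o}) :
  \sum_a y a * coboundary x a = \sum_u x u * boundary y u.
Proof.
have pull (p : arc D -> V) :
    \sum_u x u * (\sum_(a | p a == u) y a) = \sum_a y a * x (p a).
  rewrite [RHS](partition_big p predT) //=; apply: eq_bigr => u _.
  by rewrite mulr_sumr; apply: eq_bigr => a /eqP ->; rewrite mulrC.
transitivity (\sum_a y a * x (tgt a) - \sum_a y a * x (src a)).
  by rewrite -sumrB; apply: eq_bigr => a _; rewrite ffunE mulrBr.
by rewrite -!pull -sumrB; apply: eq_bigr => u _; rewrite ffunE mulrBr.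
Qed.

Lemma coboundary_eq0 (x : {ffun V -> R^o}) :
  reflect (forall u v, connect e u v -> x u = x v) (coboundary x == 0).
Proof.
apply: (iffP eqP) => [/ffunP x0 u v /connectP[p ep ->] | xc].
  elim: p u ep => //= w p IH u /andP[euw /IH <-].
  case: D_orientation => _ /(_ _ _ euw).
  case: (boolP ((u, w) \in D)) => [uD _ | _ /= wD].
    by have := x0 (Sub (u, w) uD); rewrite !ffunE => /subr0_eq.
  by have := x0 (Sub (w, u) wD); rewrite !ffunE => /subr0_eq.
apply/ffunP => -[[u v] uD]; rewrite !ffunE /= (xc u v) ?subrr //.
by apply: connect1; case: D_orientation => + _; apply.
Qed.

(** A function with zero coboundary is the same thing as a function on the
    set of component representatives. *)
Lemma dim_ker_coboundary : \dim (lker (linfun coboundary)) = n_comp e predT.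
Proof.
have e_csym := sym_connect_sym e_sym.
pose T : finType := {u | roots e u}.
have cT : #|T| = n_comp e predT.
  by rewrite card_sig /n_comp_mem; apply: eq_card => u; rewrite !inE andbT.
pose rt u : T := Sub (fingraph.root e u) (roots_root e_csym u).
pose g (z : {ffun T -> R^o}) : {ffun V -> R^o} := [ffun u => z (rt u)].
have [|G GE] := @lfun_of_linear _ _ _ g.
  by move=> c y z; apply/ffunP => u; rewrite !ffunE.
have -> : lker (linfun coboundary) = limg G.
  apply/vspaceP => x; rewrite memv_ker lfunE /=.
  apply/coboundary_eq0/memv_imgP => [xc | [z _ ->] u v uv].
    exists [ffun t => x (val t)]; rewrite ?memvf // GE; apply/ffunP => u.
    by rewrite !ffunE /=; apply/xc/connect_root.
  rewrite GE !ffunE; congr (z _); apply: val_inj => /=.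
  exact/(fingraph.rootP e_csym).
rewrite limg_dim_eq ?dim_ffun //; apply/eqP; rewrite -subv0.
apply/subvP => z; rewrite memv_cap memvf memv_ker GE memv0 /= => /eqP/ffunP z0.
apply/eqP/ffunP => -[u ru]; have := z0 u; rewrite !ffunE => <-.
by congr (z _); apply: val_inj; rewrite /= (eqP ru).
Qed.

(** With unit weights the edge form is the Euclidean inner product of chains,
    for which cycles and coboundaries are orthogonal complements. *)
Let dot : {symmetric chain R D} := edge_form (fun=> 1).

Lemma dotE y z : dot y z = \sum_a y a * z a.
Proof. by apply: eq_bigr => a _; rewrite mul1r. Qed.

Lemma cap_orthov_dot U : (U :&: orthov dot U = 0)%VS.
Proof.
apply/eqP; rewrite -subv0; apply/subvP => y.
rewrite memv_cap memv0 => /andP[yU /mem_orthovP /(_ _ yU)]; rewrite dotE => /eqP.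
rewrite psumr_eq0 => [/allP y0|a _]; last by rewrite -expr2 sqr_ge0.
apply/eqP/ffunP => a; rewrite ffunE.
by have := y0 a (mem_index_enum a); rewrite /= mulf_eq0 orbb => /eqP.
Qed.

Lemma dim_orthov_dot U : (\dim U + \dim (orthov dot U) = #|arc D|)%N.
Proof.
apply/eqP; rewrite -[X in _ == X](dim_ffun R) eqn_leq dim_orthov_ge andbT.
by rewrite -dimv_disjoint_sum ?cap_orthov_dot // dimvS ?subvf.
Qed.

Lemma cycle_space_orthov : cycle_space R D = orthov dot (limg (linfun coboundary)).
Proof.
apply/vspaceP => y; rewrite memv_ker lfunE /=.
apply/eqP/mem_orthovP => [y0 _ /memv_imgP[x _ ->] | yo].
  rewrite lfunE /= dotE coboundary_adjoint y0 big1 // => u _.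
  by rewrite ffunE mulr0.
(* pairing y with the coboundary of its own boundary gives |boundary y|^2 *)
have := yo (coboundary (boundary y)).
rewrite dotE coboundary_adjoint => /(_ _)/eqP.
rewrite psumr_eq0 => [y0|u _]; last by rewrite -expr2 sqr_ge0.
apply/ffunP => u; rewrite [RHS]ffunE.
have /y0 /allP /(_ u (mem_index_enum u)) /= :
    coboundary (boundary y) \in limg (linfun coboundary).
  by rewrite -[coboundary _](lfunE coboundary) memv_img ?memvf.
by rewrite mulf_eq0 orbb => /eqP.
Qed.

Lemma dim_cycle_space :
  (\dim (cycle_space R D) + #|V| = #|arc D| + n_comp e predT)%N.
Proof.
have := limg_ker_dim (linfun coboundary) fullv.
have := dim_orthov_dot (limg (linfun coboundary)).
rewrite -cycle_space_orthov capfv dim_ker_coboundary dim_ffun => <- <-.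
by rewrite addnCA addnC; congr (_ + _)%N; apply: addnC.
Qed.

(** The coboundaries lie in the orthogonal of the cycle space, and the two
    have the same dimension. *)
Lemma orthogonal_to_cycles (z : chain R D) :
  (forall y, y \in cycle_space R D -> \sum_a z a * y a = 0) ->
  exists x, z = coboundary x.
Proof.
move=> zZ; suff /memv_imgP[x _ ->] : z \in limg (linfun coboundary).
  by exists x; rewrite lfunE.
set B := limg _; have BZ : (B <= orthov dot (cycle_space R D))%VS.
  by rewrite cycle_space_orthov orthov_sym.
suff -> : B = orthov dot (cycle_space R D).
  by apply/mem_orthovP => y /zZ; rewrite dotE.
apply/eqP; rewrite eqEdim BZ /=.
have := dim_orthov_dot B; rewrite -cycle_space_orthov addnC.
by rewrite -(dim_orthov_dot (cycle_space R D)) => /addnI ->.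
Qed.

(** * The weighted Laplacian and the cycle form *)

Section Weights.
Variable r : arc D -> R.
Hypothesis r_neq0 : forall a, r a != 0.

Definition wcoboundary (x : {ffun V -> R^o}) : chain R D :=
  [ffun a => coboundary x a / r a].

Lemma wcoboundary_is_linear : linear wcoboundary.
Proof.
move=> c x y; apply/ffunP => a; rewrite ffunE linearP !ffunE.
by rewrite mulrDl -scalerAl.
Qed.
HB.instance Definition _ := GRing.isLinear.Build R _ _ _ wcoboundary
  wcoboundary_is_linear.

Definition laplacian (x : {ffun V -> R^o}) : {ffun V -> R^o} :=
  boundary (wcoboundary x).

Lemma laplacian_is_linear : linear laplacian.
Proof. by move=> c x y; rewrite /laplacian !linearP. Qed.
HB.instance Definition _ := GRing.isLinear.Build R _ _ _ laplacian
  laplacian_is_linear.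

Lemma laplacian_form (x : {ffun V -> R^o}) :
  \sum_u x u * laplacian x u = \sum_a coboundary x a ^+ 2 / r a.
Proof.
rewrite -coboundary_adjoint; apply: eq_bigr => a _.
by rewrite [wcoboundary x a]ffunE mulrAC expr2.
Qed.

Let X : {symmetric subvs_of (cycle_space R D)} := cycle_form r.

(** A cycle y is in the radical of X_r iff r y is orthogonal to all cycles, that
    is, iff r y is a coboundary. *)
Lemma mem_nullity_space (y : subvs_of (cycle_space R D)) :
  reflect (exists x, vsval y = wcoboundary x)
          (y \in orthov X fullv).
Proof.
apply: (iffP mem_orthovP) => [yK | [x yx] w _].
  have [z zZ|x xE] := @orthogonal_to_cycles [ffun a => r a * vsval y a].
    apply: etrans (yK (Subvs zZ) (memvf _)).
    by apply: eq_bigr => a _; rewrite ffunE.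
  exists x; apply/ffunP => a; rewrite ffunE -xE ffunE mulrAC divff ?mul1r //.
have := subvsP w; rewrite memv_ker lfunE /= => /eqP/ffunP w0.
rewrite /= /cycle_form /edge_form.
transitivity (\sum_u x u * boundary (vsval w) u).
  rewrite -coboundary_adjoint; apply: eq_bigr => a _.
  by rewrite yx ffunE mulrCA divff // mulr1 mulrC.
by apply: big1 => u _; rewrite w0 ffunE mulr0.
Qed.

(** x is in the kernel of the Laplacian iff (d x) / r is a cycle, and then this
    cycle is in the radical of X_r. So x |-> (d x) / r maps the kernel of the
    Laplacian onto that radical, with fibre ker d. *)
Lemma dim_ker_laplacian :
  \dim (lker (linfun laplacian)) = (n_comp e predT + nullity (cycle_form r))%N.
Proof.
have kerE : lker (linfun wcoboundary) = lker (linfun coboundary).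
  apply/vspaceP => x; rewrite !memv_ker !lfunE /=.
  apply/eqP/eqP => /ffunP x0; apply/ffunP => a; have := x0 a; rewrite !ffunE.
    by move/eqP; rewrite mulf_eq0 invr_eq0 (negPf (r_neq0 a)) orbF => /eqP.
  by move=> ->; rewrite mul0r.
rewrite -(limg_ker_dim (linfun wcoboundary)) (capv_idPr _); last first.
  apply/subvP => x; rewrite !memv_ker !lfunE /= /laplacian => /eqP ->.
  by rewrite linear0.
rewrite kerE dim_ker_coboundary; congr (_ + _)%N.
pose i := linfun (vsval : subvs_of (cycle_space R D) -> chain R D).
rewrite /nullity -(@limg_dim_eq _ _ _ i); last first.
  apply/eqP; rewrite -subv0; apply/subvP => y; rewrite memv_cap memv_ker memv0.
  by rewrite lfunE /= => /andP[_ /eqP y0]; apply/eqP/val_inj; apply: y0.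
congr (\dim _); apply/vspaceP => y; apply/memv_imgP/memv_imgP.
  case=> x; rewrite memv_ker !lfunE /= => /eqP x0 ->.
  have xZ : wcoboundary x \in cycle_space R D by rewrite memv_ker lfunE; apply/eqP.
  exists (Subvs xZ); last by rewrite lfunE.
  by apply/mem_nullity_space; exists x.
case=> z /mem_nullity_space[x zx] ->; exists x; last by rewrite !lfunE.
by have := subvsP z; rewrite zx !memv_ker !lfunE.
Qed.

(** A chain of U vanishing on all arcs of negative weight would have nonnegative
    square, hence zero square, hence be zero: U embeds in the functions on the
    arcs of negative weight. *)
Lemma dim_nonpos_chains (U : {vspace chain R D}) :
  {in U, forall z : chain R D, \sum_a z a ^+ 2 / r a <= 0} ->
  (\dim U <= #|[set a | (r a < 0)%R]|)%N.
Proof.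
move=> Uneg; pose T : finType := {a | r a < 0}.
have -> : #|[set a | (r a < 0)%R]| = #|T|.
  by rewrite card_sig; apply: eq_card => a; rewrite !inE.
pose g (z : chain R D) : {ffun T -> R^o} := [ffun t => z (val t)].
have [|G GE] := @lfun_of_linear _ _ _ g.
  by move=> c y z; apply/ffunP => u; rewrite !ffunE.
rewrite -(dim_ffun R); apply: (@dim_le_inj _ _ _ G) => z zU.
rewrite GE => /ffunP z0; have zneg a : r a < 0 -> z a = 0.
  by move=> ra; have := z0 (Sub a ra); rewrite !ffunE.
have sq_ge0 a : 0 <= z a ^+ 2 / r a.
  have [/zneg ->|ra] := ltP (r a) 0; first by rewrite expr0n mul0r.
  by rewrite divr_ge0 ?sqr_ge0.
have /eqP : \sum_a z a ^+ 2 / r a = 0.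
  by apply/le_anti; rewrite Uneg // sumr_ge0.
rewrite psumr_eq0 // => /allP zz; apply/ffunP => a.
have := zz a (mem_index_enum a).
by rewrite /= mulf_eq0 invr_eq0 (negPf (r_neq0 a)) orbF sqrf_eq0 ffunE => /eqP.
Qed.

(** The subspaces d N and r M of the space of chains are orthogonal for
    \sum_a z_a z'_a / r_a because M consists of cycles. They are independent
    because a common vector d x = r y would have zero square. *)
Lemma dim_negative_add (N : {vspace {ffun V -> R^o}})
    (M : {vspace subvs_of (cycle_space R D)}) :
  {in N, forall x : {ffun V -> R^o}, x != 0 -> \sum_u x u * laplacian x u < 0} ->
  {in M, forall y, cycle_form r y y <= 0} ->
  (\dim N + \dim M <= #|[set a | (r a < 0)%R]|)%N.
Proof.
move=> Nneg Mneg.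
pose g (y : subvs_of (cycle_space R D)) : chain R D :=
  [ffun a => r a * vsval y a].
have [|G GE] := @lfun_of_linear _ _ _ g.
  move=> c y z; apply/ffunP => a; rewrite ffunE linearP !ffunE mulrDr.
  by congr (_ + _); rewrite scalerAr.
pose d := linfun coboundary.
have cross (x : {ffun V -> R^o}) y : \sum_a coboundary x a * g y a / r a = 0.
  transitivity (\sum_u x u * boundary (vsval y) u).
    rewrite -coboundary_adjoint; apply: eq_bigr => a _.
    by rewrite [g y a]ffunE mulrCA mulrAC divff // mul1r mulrC.
  have := subvsP y; rewrite memv_ker lfunE /= => /eqP/ffunP y0.
  by apply: big1 => u _; rewrite y0 ffunE mulr0.
have selfcross x y : coboundary x = g y -> x \in N -> x = 0.
  move=> xy xN; apply: contraTeq isT => x0; have := Nneg _ xN x0.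
  have := cross x y; rewrite -xy; under eq_bigr do rewrite -expr2.
  by rewrite -laplacian_form => ->; rewrite ltxx.
have dN : \dim (d @: N) = \dim N.
  apply: limg_dim_eq; apply/eqP; rewrite -subv0; apply/subvP => x.
  rewrite memv_cap memv_ker memv0 lfunE /= => /andP[xN /eqP x0].
  apply/eqP/(@selfcross _ 0) => //; rewrite x0; apply/ffunP => a.
  by rewrite !ffunE mulr0.
have dM : \dim (G @: M) = \dim M.
  apply: limg_dim_eq; apply/eqP; rewrite -subv0; apply/subvP => y.
  rewrite memv_cap memv_ker memv0 GE => /andP[_ /eqP/ffunP y0].
  apply/eqP/val_inj/ffunP => a; have := y0 a; rewrite !ffunE => /eqP.
  by rewrite mulf_eq0 (negPf (r_neq0 a)) => /eqP.
rewrite -dN -dM -dimv_disjoint_sum; last first.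
  apply/eqP; rewrite -subv0; apply/subvP => z; rewrite memv_cap memv0.
  case/andP => /memv_imgP[x xN ->] /memv_imgP[y _]; rewrite lfunE GE /= => xy.
  by rewrite (selfcross _ _ xy xN) linear0.
apply: dim_nonpos_chains => z.
case/memv_addP => u /memv_imgP[x xN ->] [v /memv_imgP[y yM ->] ->].
rewrite lfunE GE /=.
have -> : \sum_a (coboundary x + g y) a ^+ 2 / r a =
    \sum_u x u * laplacian x u + cycle_form r y y.
  transitivity (\sum_a coboundary x a ^+ 2 / r a + cycle_form r y y
      + (\sum_a coboundary x a * g y a / r a) *+ 2); last first.
    by rewrite cross mul0rn addr0 laplacian_form.
  rewrite -sumrMnl -!big_split; apply: eq_bigr => a _ /=.
  rewrite ffunE [g y a]ffunE; field; exact: r_neq0.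
have := Mneg _ yM; have [-> | x0] := eqVneq x 0.
  by rewrite linear0 big1 ?add0r // => w _; rewrite ffunE mul0r.
by have := Nneg _ xN x0; lra.
Qed.

End Weights.
End Graph.

(** * Eigenvalues of real symmetric matrices *)

Section Spectral.
Variable R : rcfType.

(** Over R[i] the matrix is unitarily similar to a real diagonal matrix; two
    real matrices that are similar over R[i] are similar through a real
    matrix. *)
Lemma real_diagonalization n (H : 'M[R]_n) : H^T = H ->
  exists (P : 'M[R]_n) (d : 'rV[R]_n), P \in unitmx /\ P *m H = diag_mx d *m P.
Proof.
move=> Hs; pose C := R[i]; pose f : {rmorphism R -> C} := real_complex R.
pose A := map_mx f H.
have Ar : A \is a mxOver Num.real.
  by apply/mxOverP => i j; rewrite mxE; apply/complex_realP; exists (H i j).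
have Ah : A \is hermsymmx.
  apply/is_hermitianmxP; rewrite expr0 scale1r; apply/matrixP => i j.
  by rewrite !mxE conj_Creal ?complex_real // -{1}Hs mxE.
have Dr := hermitian_spectral_diag_real Ah.
have /orthomx_spectralP EA := hermitian_normalmx Ah.
have Pu := spectral_unit A.
have [||P] := @real_similar C n A (diag_mx (spectral_diag A)) _ Ar _.
- exists (spectralmx A) => //; apply/similarP => //.
  by rewrite {2}EA !mulmxA mulmxV // mul1mx.
- apply/mxOverP => i j; rewrite mxE; case: eqP => _; last by rewrite mulr0n rpred0.
  by rewrite mulr1n (mxOverP Dr).
rewrite inE => /andP[/mxOverP Pr Punit] /(similarP Punit) PA.
have reK m k (M : 'M[C]_(m, k)) : (forall i j, M i j \is Num.real) ->
    M = map_mx f (map_mx (@complex.Re R) M).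
  by move=> Mr; apply/matrixP => i j; rewrite !mxE /f /= RRe_real.
exists (map_mx (@complex.Re R) P), (map_mx (@complex.Re R) (spectral_diag A)).
split; first by move: Punit; rewrite {1}(reK _ _ P Pr) map_unitmx.
apply: (map_mx_inj (f := f)).
rewrite !map_mxM map_diag_mx -!reK //; exact/mxOverP.
Qed.

Lemma char_poly_similar n (P A B : 'M[R]_n) :
  P \in unitmx -> P *m A = B *m P -> char_poly A = char_poly B.
Proof.
move=> Pu PA; have Pp : map_mx polyC P \in unitmx.
  by rewrite unitmxE det_map_mx rmorph_unit // -unitmxE.
apply: (@mulIr _ (\det (map_mx polyC P))); first by rewrite -unitmxE.
rewrite [LHS]mulrC -!det_mulmx; congr (\det _).
rewrite /char_poly_mx mulmxBr mulmxBl -!map_mxM PA.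
by rewrite mul_mx_scalar mul_scalar_mx.
Qed.

Lemma eigenvalues_diag n (H P : 'M[R]_n) (d : 'rV[R]_n) :
  H^T = H -> P \in unitmx -> P *m H = diag_mx d *m P ->
  perm_eq (eigenvalues H) [seq d 0 i | i <- enum 'I_n].
Proof.
move=> Hs Pu PH; apply/allP => x _ /=.
rewrite -!mu_prod_XsubC -char_poly_eigenvalues // (char_poly_similar Pu PH).
rewrite char_poly_trig ?diag_mx_is_trig // big_map big_enum /=.
by apply/eqP; congr (mup _ _); apply: eq_bigr => i _; rewrite mxE eqxx mulr1n.
Qed.

Lemma count_eigenvalues n (H P : 'M[R]_n) (d : 'rV[R]_n) (p : pred R) :
  H^T = H -> P \in unitmx -> P *m H = diag_mx d *m P ->
  count p (eigenvalues H) = #|[set i | p (d 0 i)]|.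
Proof.
move=> Hs Pu PH; rewrite (permP (eigenvalues_diag Hs Pu PH)) count_map.
by rewrite -sum1_count big_enum_cond -sum1dep_card.
Qed.

Lemma upper_label_count n (H : 'M[R]_n) lam : H^T = H -> eigenvalue H lam ->
  upper_label H lam = count (<= lam) (eigenvalues H).
Proof.
move=> Hs; rewrite eigenvalue_root_char char_poly_eigenvalues //.
rewrite root_prod_XsubC -Order.POrderTheory.count_lt_le_mem /upper_label.
have := eigenvalues_sorted H; set s := eigenvalues H => ss lt_le.
apply/eqP; rewrite eqn_leq; apply/andP; split.
  apply/bigmax_leqP => k /eqP sk; rewrite ltnNge; apply/negP => le_k.
  (* entries from index #{eigenvalues <= lam} on exceed lam *)
  have := @nth_count_gt _ _ lam 0 s k ss; rewrite le_k ltn_ord sk ltxx.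
  by move=> /(_ isT).
case cE : (count (<= lam) s) lt_le => [//|m] lt_m.
have ms : (m < size s)%N by rewrite -cE count_size.
rewrite (leq_bigmax_cond (Ordinal ms)) //=; apply/eqP.
by apply: nth_count_eq => //; rewrite cE ltnSn andbT.
Qed.

(** The eigenvectors forming the rows of P need not be orthogonal. But the Gram
    matrix G = P P^T commutes with the diagonal matrix d of eigenvalues, hence
    with s = sqrt(- d), so that on the span of the eigenvectors with negative
    eigenvalues b P M P^T b^T = b d G b^T = - (b s) G (b s)^T = - |b s P|^2. *)
Lemma negative_on_eigenvectors n (M P : 'M[R]_n) (d b : 'rV[R]_n) :
  M^T = M -> P \in unitmx -> P *m M = diag_mx d *m P ->
  (forall i, b 0 i != 0 -> d 0 i < 0) -> b != 0 ->
  (b *m P *m M *m (b *m P)^T) 0 0 < 0.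
Proof.
move=> Ms Pu PM bneg b0; pose G := P *m P^T.
have GT : G^T = G by rewrite /G trmx_mul trmxK.
have dG : diag_mx d *m G = G *m diag_mx d.
  rewrite -[RHS]trmxK trmx_mul tr_diag_mx GT mulmxA -PM.
  by rewrite !trmx_mul Ms trmxK mulmxA.
pose s : 'rV[R]_n := \row_i Num.sqrt (- d 0 i).
have sG : diag_mx s *m G = G *m diag_mx s.
  apply/matrixP => i j; have /matrixP /(_ i j) := dG.
  rewrite !mul_diag_mx !mul_mx_diag !mxE => /eqP.
  rewrite [X in _ == X]mulrC [RHS]mulrC -subr_eq0 -mulrBl mulf_eq0 subr_eq0.
  by case/orP => /eqP ->; rewrite ?mulr0.
have bd : b *m diag_mx d = - (b *m diag_mx s *m diag_mx s).
  apply/rowP => i; rewrite !mul_mx_diag !mxE -mulrA -expr2.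
  have [-> | /bneg di] := eqVneq (b 0 i) 0; first by rewrite !mul0r oppr0.
  by rewrite sqr_sqrtr ?mulrN ?opprK // oppr_ge0 ltW.
pose v := b *m diag_mx s *m P.
have -> : b *m P *m M *m (b *m P)^T = - (v *m v^T).
  rewrite -(mulmxA b) PM !mulmxA bd !trmx_mul !mulmxA tr_diag_mx !mulNmx.
  congr (- _); rewrite -!mulmxA; congr (_ *m _); rewrite !mulmxA.
  by rewrite -!(mulmxA _ P P^T) -/G -(mulmxA _ G) -sG !mulmxA.
rewrite mxE oppr_lt0 mxE lt_def sumr_ge0 ?andbT => [|i _]; last first.
  by rewrite [v^T _ _]mxE -expr2 sqr_ge0.
rewrite psumr_neq0 => [|i _]; last by rewrite [v^T _ _]mxE -expr2 sqr_ge0.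
have /rV0Pn[i vi] : v != 0.
  apply: contraNneq b0 => /(congr1 (mulmx^~ (invmx P))).
  rewrite /v mulmxK // mul0mx => /rowP bs; apply/eqP/rowP => i.
  rewrite [RHS]mxE; apply: contraTeq isT => bi; have := bs i.
  rewrite mul_mx_diag !mxE => /eqP; rewrite mulf_eq0 (negPf bi) /= sqrtr_eq0.
  by rewrite oppr_le0 leNgt bneg.
apply/hasP; exists i; rewrite ?mem_index_enum //= [v^T _ _]mxE.
by rewrite -expr2 exprn_even_gt0.
Qed.

End Spectral.

(** * The Laplacian attached to an eigenvector without zeros *)

Section NodalLaplacian.
Variables (R : rcfType) (V : finType) (e : rel V) (D : {set V * V}).
Variables (H : 'M[R]_#|V|) (lam : R) (psi : 'rV[R]_#|V|).
Hypotheses (D_orientation : orientation e D) (e_sym : symmetric e).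
Hypotheses (H_sym : H^T = H) (H_supp : strictly_supported e H).
Hypotheses (psi_eigen : (psi <= eigenspace H lam)%MS).
Hypothesis psi_neq0 : forall u : V, coor psi u != 0.

Let r := nodal_weight (D := D) psi H.
Let M := H - lam%:M.

Lemma entryC u v : entry H u v = entry H v u.
Proof. by rewrite /entry -{1}H_sym mxE. Qed.

Lemma sum_entries (phi : 'rV[R]_#|V|) u :
  \sum_v coor phi v * entry H v u = (phi *m H) 0 (enum_rank u).
Proof. by rewrite mxE [RHS](reindex _ (onW_bij _ (@enum_rank_bij V))). Qed.

Lemma nodal_weight_neq0 a : r a != 0.
Proof.
case: a => -[u v] uvD; rewrite /r /nodal_weight /src /tgt /= oppr_eq0 invr_eq0.
have uv : e u v by case: D_orientation => + _; apply.
have u_v : u != v.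
  apply: contraTneq uv => ->; apply/negP => evv.
  by case: D_orientation => _ /(_ _ _ evv); rewrite addbb.
by rewrite !mulf_neq0 // H_supp.
Qed.

Lemma sum_arcs_at (F : V -> R) u :
  \sum_(a : arc D | tgt a == u) F (src a) +
  \sum_(a : arc D | src a == u) F (tgt a) = \sum_(v | e u v) F v.
Proof.
pose A := [pred v | (v, u) \in D]; pose B := [pred v | (u, v) \in D].
have -> : \sum_(a : arc D | tgt a == u) F (src a) = \sum_(v in A) F v.
  rewrite -(big_sub_cond (mem D) [pred p | p.2 == u] (fun p => F p.1)).
  rewrite (reindex_onto (fun v => (v, u)) fst) /= => [|[v w] /andP[_ /eqP <-] //].
  by apply: eq_bigl => v; rewrite !inE /= !eqxx !andbT.
have -> : \sum_(a : arc D | src a == u) F (tgt a) = \sum_(v in B) F v.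
  rewrite -(big_sub_cond (mem D) [pred p | p.1 == u] (fun p => F p.2)).
  rewrite (reindex_onto (fun v => (u, v)) snd) /= => [|[v w] /andP[_ /eqP <-] //].
  by apply: eq_bigl => v; rewrite !inE /= !eqxx !andbT.
have [DE /(_ _ _)/[dup] Dx _] := D_orientation.
rewrite [RHS](bigID (mem A)) /=; congr (_ + _); apply: eq_bigl => v.
  rewrite inE andbC; case vuD: (_ \in D) => //=.
  by rewrite e_sym (DE _ _ vuD).
rewrite !inE; case uv: (e u v); last by apply: contraFF uv => /DE.
by have := Dx _ _ uv; do 2!case: (_ \in D).
Qed.

Definition scale_psi (x : {ffun V -> R^o}) : 'rV[R]_#|V| :=
  \row_j (x (enum_val j) * psi 0 j).

Lemma scale_psi_is_linear : linear scale_psi.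
Proof. by move=> c x y; apply/rowP => j; rewrite !mxE !ffunE mulrDl -mulrA. Qed.
HB.instance Definition _ := GRing.isLinear.Build R _ _ _ scale_psi
  scale_psi_is_linear.

Lemma coor_scale_psi x u : coor (scale_psi x) u = x u * coor psi u.
Proof. by rewrite /coor mxE enum_rankK. Qed.

Lemma scale_psi_inj x : scale_psi x = 0 -> x = 0.
Proof.
move=> x0; apply/ffunP => u; apply/eqP; rewrite ffunE.
have /eqP := coor_scale_psi x u.
by rewrite x0 /coor mxE eq_sym mulf_eq0 (negPf (psi_neq0 u)) orbF.
Qed.

(** The sum over the neighbours of u extends to all vertices, since H vanishes
    off the edges and the term at u is zero; its x_u part is then x_u times
    (psi H)_u = lam psi_u. *)
Lemma laplacian_scale_psi (x : {ffun V -> R^o}) u :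
  laplacian r x u = coor psi u * coor (scale_psi x *m M) u.
Proof.
pose F v := coor psi v * entry H v u * coor psi u * (x v - x u).
have -> : laplacian r x u = \sum_v F v.
  transitivity (\sum_(v | e u v) F v); last first.
    rewrite big_mkcond; apply: eq_bigr => v _; case: ifPn => // uv.
    rewrite /F; have [-> | vu] := eqVneq v u; first by rewrite subrr mulr0.
    have := H_supp vu; rewrite e_sym (negPf uv) => /negbFE/eqP ->.
    by rewrite mulr0 !mul0r.
  rewrite -sum_arcs_at ffunE /inflow /outflow -sumrN; congr (_ + _).
    apply: eq_bigr => a /eqP au; rewrite !ffunE /r /nodal_weight /F au.
    by rewrite invrN invrK; ring.
  apply: eq_bigr => a /eqP au; rewrite !ffunE /r /nodal_weight /F au.
  by rewrite invrN invrK (entryC (tgt a)); ring.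
have psiH : \sum_v coor psi v * entry H v u = lam * coor psi u.
  by rewrite sum_entries (eigenspaceP psi_eigen) mxE.
transitivity (coor psi u * (\sum_v coor (scale_psi x) v * entry H v u)
    - coor psi u * (x u * \sum_v coor psi v * entry H v u)).
  rewrite !mulr_sumr -sumrB; apply: eq_bigr => v _; rewrite coor_scale_psi /F.
  ring.
rewrite psiH sum_entries -mulrBr /M mulmxBr mul_mx_scalar; congr (_ * _).
rewrite [RHS]mxE; congr (_ + _); rewrite !mxE enum_rankK /coor.
by rewrite mulrCA.
Qed.

Lemma laplacian_form_scale_psi (x : {ffun V -> R^o}) :
  \sum_u x u * laplacian r x u =
  (scale_psi x *m M *m (scale_psi x)^T) 0 0.
Proof.
rewrite [RHS]mxE [RHS](reindex _ (onW_bij _ (@enum_rank_bij V))).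
apply: eq_bigr => u _; rewrite laplacian_scale_psi [_^T _ _]mxE -/(coor _ u).
by rewrite -/(coor (scale_psi x) u) coor_scale_psi; ring.
Qed.

(** x |-> x psi identifies the kernel of the Laplacian with the eigenspace; the
    row base of the eigenspace matrix gives it as a space of vectors. *)
Lemma dim_ker_nodal_laplacian :
  \dim (lker (linfun (laplacian r))) = \rank (eigenspace H lam).
Proof.
set K := lker _; have memK x : (x \in K) = (scale_psi x <= eigenspace H lam)%MS.
  rewrite memv_ker lfunE /=; apply/eqP/idP => [/ffunP x0 | /sub_kermxP x0].
    apply/sub_kermxP/rowP => j; have := x0 (enum_val j).
    rewrite laplacian_scale_psi !ffunE => /eqP; rewrite mulf_eq0.
    by rewrite (negPf (psi_neq0 _)) /= /coor enum_valK [RHS]mxE => /eqP.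
  by apply/ffunP => u; rewrite laplacian_scale_psi x0 ffunE /coor mxE mulr0.
pose k := \rank (eigenspace H lam).
have [|G GE] := @lfun_of_linear _ 'rV[R]_k {ffun V -> R^o}
    (fun c => [ffun u => coor (c *m row_base (eigenspace H lam)) u / coor psi u]).
  move=> c y z; apply/ffunP => u; rewrite !ffunE /coor mulmxDl -scalemxAl.
  by rewrite mxE mxE mulrDl -mulrA.
have scaleG c : scale_psi (G c) = c *m row_base (eigenspace H lam).
  apply/rowP => j; rewrite mxE GE ffunE /coor enum_valK divfK //.
  by have := psi_neq0 (enum_val j); rewrite /coor enum_valK.
have -> : K = limg G.
  apply/vspaceP => x; rewrite memK -(eq_row_base (eigenspace H lam)).
  apply/submxP/memv_imgP => [[c xc] | [c _ ->]]; last by exists c; rewrite scaleG.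
  exists c; rewrite ?memvf //; apply/subr0_eq/scale_psi_inj.
  by rewrite linearB /= scaleG xc subrr.
rewrite limg_dim_eq; first by rewrite dimvf /dim /= mul1n.
apply/eqP; rewrite -subv0; apply/subvP => c.
rewrite memv_cap memvf memv_ker memv0 /= => /eqP c0.
have := scaleG c; rewrite c0 linear0 => /esym/eqP.
by rewrite mulmx_free_eq0 // row_base_free.
Qed.

Section Coordinates.
Variables (P : 'M[R]_#|V|) (d : 'rV[R]_#|V|).
Hypotheses (P_unit : P \in unitmx) (PH : P *m H = diag_mx d *m P).

Definition eigencoor x : 'rV[R]_#|V| := scale_psi x *m invmx P.

(** N is the space of all x such that x psi is a combination of the rows of P
    whose eigenvalue satisfies p. *)
Lemma spectral_subspace (p : pred R) : exists2 N : {vspace {ffun V -> R^o}},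
  forall x, x \in N -> forall i, eigencoor x 0 i != 0 -> p (d 0 i) &
  (#|[set i | p (d 0%R i)]| <= \dim N)%N.
Proof.
pose T : finType := {i | ~~ p (d 0 i)}.
have [|G GE] := @lfun_of_linear _ _ _
    (fun x : {ffun V -> R^o} =>
       [ffun t : T => eigencoor x 0 (val t)] : {ffun T -> R^o}).
  move=> c x y; apply/ffunP => t; rewrite !ffunE /eigencoor linearP mulmxDl.
  by rewrite -scalemxAl !mxE.
exists (lker G) => [x | ].
  rewrite memv_ker GE => /eqP/ffunP x0 i; apply: contraNT => pi.
  by have := x0 (Sub i pi); rewrite !ffunE => /eqP.
have := dim_cap_lker_ge G fullv; rewrite capfv !dim_ffun card_sig.
move=> dimG; rewrite -(leq_add2r #|[pred i | ~~ p (d 0 i)]|).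
apply: leq_trans dimG.
apply/eq_leq/(etrans _ (etrans (cardC [set i | p (d 0 i)]) (card_ord _))).
by congr (_ + _)%N; apply: eq_card => i; rewrite !inE.
Qed.

Lemma laplacian_form_neg (x : {ffun V -> R^o}) :
  (forall i, eigencoor x 0 i != 0 -> d 0 i < lam) -> x != 0 ->
  \sum_u x u * laplacian r x u < 0.
Proof.
move=> xneg x0; rewrite laplacian_form_scale_psi.
rewrite -[scale_psi x](mulmxKV P_unit) -/(eigencoor x).
apply: (@negative_on_eigenvectors _ _ M P (d - const_mx lam)) => //.
- by rewrite /M linearB /= H_sym tr_scalar_mx.
- rewrite /M mulmxBr PH linearB /= mulmxBl diag_const_mx.
  by rewrite mul_mx_scalar mul_scalar_mx.
- by move=> i /xneg; rewrite !mxE subr_lt0.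
apply: contraNneq x0 => x0; apply/eqP/scale_psi_inj.
by rewrite -[scale_psi x](mulmxKV P_unit) -/(eigencoor x) x0 mul0mx.
Qed.

Lemma laplacian_form_pos (x : {ffun V -> R^o}) :
  (forall i, eigencoor x 0 i != 0 -> lam < d 0 i) -> x != 0 ->
  0 < \sum_u x u * laplacian r x u.
Proof.
move=> xpos x0; rewrite laplacian_form_scale_psi -oppr_lt0.
rewrite -[scale_psi x](mulmxKV P_unit) -/(eigencoor x).
set b := eigencoor x; set Q := b *m P.
have -> : - (Q *m M *m Q^T) 0 0 = (Q *m (- M) *m Q^T) 0 0.
  by rewrite mulmxN mulNmx [RHS]mxE.
apply: (@negative_on_eigenvectors _ _ (- M) P (const_mx lam - d)) => //.
- by rewrite /M !linearN linearB /= H_sym tr_scalar_mx.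
- rewrite /M mulmxN mulmxBr PH opprB linearB /= mulmxBl diag_const_mx.
  by rewrite mul_mx_scalar mul_scalar_mx.
- by move=> i /xpos; rewrite !mxE subr_lt0.
apply: contraNneq x0 => x0; apply/eqP/scale_psi_inj.
by rewrite -[scale_psi x](mulmxKV P_unit) -/(eigencoor x) -/b x0 mul0mx.
Qed.

Lemma ker_laplacian_eigencoor x :
  (forall i, eigencoor x 0 i != 0 -> d 0 i == lam) ->
  x \in lker (linfun (laplacian r)).
Proof.
move=> xe; rewrite memv_ker lfunE /=; apply/eqP/ffunP => u.
rewrite laplacian_scale_psi -[scale_psi x](mulmxKV P_unit) -/(eigencoor x).
rewrite /M mulmxBr -mulmxA PH mul_mx_scalar mulmxA.
have -> : eigencoor x *m diag_mx d = lam *: eigencoor x.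
  apply/rowP => i; rewrite mul_mx_diag !mxE mulrC.
  have [x0|/xe/eqP -> //] := eqVneq (eigencoor x 0 i) 0.
  by have := x0; rewrite !mxE => ->; rewrite !mulr0.
by rewrite -scalemxAl subrr /coor mxE mulr0 ffunE.
Qed.

End Coordinates.
End NodalLaplacian.

(** * Nodal count and multiplicity *)

Lemma nodal_count_weight (R : rcfType) (V : finType) (D : {set V * V})
    (H : 'M[R]_#|V|) (psi : 'rV[R]_#|V|) :
  nodal_count D psi H = #|[set a | (nodal_weight (D := D) psi H a < 0)%R]|.
Proof.
rewrite /nodal_count -sum1dep_card -[RHS]sum1dep_card.
rewrite (big_sub_cond (mem D)
  [pred a | (0 < coor psi a.1 * entry H a.1 a.2 * coor psi a.2)%R]).
by apply: eq_bigl => a; rewrite /nodal_weight /= oppr_lt0 invr_gt0.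
Qed.

Theorem theorem1p1 (R : rcfType) (V : finType) (e : rel V) (D : {set V * V})
    (H : 'M[R]_#|V|) (lam : R) (psi : 'rV[R]_#|V|)
    (e_sym : symmetric e) (e_irr : irreflexive e)
    (D_orientation : orientation e D)
    (H_sym : H^T = H) (H_supp : strictly_supported e H)
    (lam_eigen : eigenvalue H lam)
    (psi_eigen : (psi <= eigenspace H lam)%MS)
    (psi_neq0 : forall u : V, coor psi u != 0) :
  let c := n_comp e predT in
  let X := cycle_form (nodal_weight (D := D) psi H) in
  \rank (eigenspace H lam) = (c + nullity X)%N /\
  (nodal_count D psi H)%:Z
    = (upper_label H lam)%:Z - c%:Z + (morse_index X)%:Z.
Proof.
move=> c X; set r := nodal_weight psi H in X *.
have r_neq0 := nodal_weight_neq0 D_orientation H_supp psi_neq0.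
have kerL := dim_ker_laplacian e_sym D_orientation r_neq0.
have rankE := dim_ker_nodal_laplacian D_orientation e_sym H_sym H_supp
  psi_eigen psi_neq0.
split; first by rewrite -rankE kerL.
have [P [d [Pu PH]]] := real_diagonalization H_sym.
have [M [Q [Mneg Qpos dM dQ]]] := semidefinite_subspaces X.
have [N1 N1P dN1] := spectral_subspace psi P d (fun t => t < lam).
have [N2 N2P dN2] := spectral_subspace psi P d (fun t => t == lam).
have [N3 N3P dN3] := spectral_subspace psi P d (fun t => lam < t).
(* the two index bounds, for r and for - r *)
have neg_bound : (\dim N1 + \dim M <= #|[set a | (r a < 0)%R]|)%N.
  apply: dim_negative_add => // x xN.
  exact: (laplacian_form_neg D_orientation e_sym H_sym H_supp psi_eigen
    psi_neq0 Pu PH (N1P _ xN)).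
have pos_bound : (\dim N3 + \dim Q <= #|[set a | (- r a < 0)%R]|)%N.
  apply: (@dim_negative_add _ _ _ (fun a => - r a)) => [a | x xN x0 | y yQ].
  - by rewrite oppr_eq0.
  - have := laplacian_form_pos D_orientation e_sym H_sym H_supp psi_eigen
      psi_neq0 Pu PH (N3P _ xN) x0.
    rewrite !laplacian_form -oppr_lt0 -sumrN.
    by under eq_bigr do rewrite -mulrN -invrN.
  - have := Qpos _ yQ; rewrite -oppr_le0 /X /= /cycle_form /edge_form -sumrN.
    by under eq_bigr do rewrite -!mulNr.
have ker_bound : (\dim N2 <= \dim (lker (linfun (laplacian r))))%N.
  apply/dimvS/subvP => x xN.
  exact: (ker_laplacian_eigencoor D_orientation e_sym H_sym H_supp psi_eigen
    Pu PH (N2P _ xN)).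
have cardA : (#|[set a | (r a < 0)%R]| + #|[set a | (- r a < 0)%R]|
    = #|Defs.arc D|)%N.
  rewrite -(cardC [set a | (r a < 0)%R]); congr (_ + _)%N.
  apply: eq_card => a; rewrite !inE oppr_lt0 -leNgt lt_def.
  by rewrite r_neq0.
have card_le : #|[set i | d 0 i <= lam]| =
    (#|[set i | (d 0%R i < lam)%R]| + #|[set i | (d 0%R i == lam)%R]|)%N.
  rewrite -(cardsID [set i | d 0 i == lam]) addnC; congr (_ + _)%N.
    by apply: eq_card => i; rewrite !inE lt_neqAle.
  by apply: eq_card => i; rewrite !inE le_eqVlt; case: eqP; rewrite ?andbF.
have cardV : (#|[set i | (d 0%R i <= lam)%R]|
    + #|[set i | (lam < d 0%R i)%R]| = #|V|)%N.
  apply: etrans (etrans (cardsC [set i | d 0 i <= lam]) (card_ord _)).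
  by congr (_ + _)%N; apply: eq_card => i; rewrite !inE ltNge.
have labelE : upper_label H lam = #|[set i | (d 0 i <= lam)%R]|.
  by rewrite upper_label_count // (count_eigenvalues _ H_sym Pu PH).
have dZ := dim_cycle_space R e_sym D_orientation.
(* neg_bound and pos_bound add up to an equality by cardA, cardV and dZ, so
   each of the inequalities is an equality *)
have arith (c' k mo m q n1 n2 n3 kL lt eq gt le v neg pos a z : nat) :
    kL = (c' + k)%N -> m = (mo + k)%N -> (z <= mo + q)%N ->
    (lt <= n1)%N -> (eq <= n2)%N -> (gt <= n3)%N ->
    (n1 + m <= neg)%N -> (n3 + q <= pos)%N -> (n2 <= kL)%N ->
    (neg + pos = a)%N -> le = (lt + eq)%N -> (le + gt = v)%N ->
    (z + v = a + c')%N -> neg%:Z = le%:Z - c'%:Z + mo%:Z.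
  lia.
rewrite nodal_count_weight -/r labelE.
rewrite dimvf in dQ.
exact: (arith _ _ _ _ _ _ _ _ _ _ _ _ _ _ _ _ _ _ kerL dM dQ dN1 dN2 dN3
  neg_bound pos_bound ker_bound cardA card_le cardV dZ).
Qed.
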